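(* Let $d\ge 1$, let $G=(V,E)$ be a graph, and let $p:V\to\mathbb{R}^d$ and $a:V\to\mathbb{N}$. Then, as multisets, $$\mathrm{Spec}\left(L(G^{(a)},p^{(a)})\right)=\left(\bigcup_{v\in V}\mathrm{Spec}(L_a^v(G,p))^{[a(v)-1]}\right)\cup \mathrm{Spec}(L_a(G,p)).$$
   Context: All graphs are finite and simple; $\mathbb{N}=\{1,2,3,\dots\}$. For a graph $G=(V,E)$ and $p:V\to\mathbb{R}^d$ (not necessarily injective), for $u,v\in V$ put $d_{uv}=\frac{p(u)-p(v)}{\|p(u)-p(v)\|}$ if $p(u)\neq p(v)$ and $d_{uv}=0$ otherwise. Weighted matrices: for $f:V\to\mathbb{R}_{>0}$, the weighted rigidity matrix $R_f(G,p)\in\mathbb{R}^{d|V|\times|E|}$ has rows indexed by pairs $(u,i)$, $u\in V$, $1\le i\le d$, columns indexed by edges, and entries $R_f(G,p)_{(u,i),e}=\sqrt{f(v)}\,(d_{uv})_i$ if $e=\{u,v\}$ for some $v\in V$, and $0$ if $u\notin e$. Put $L_f(G,p)=R_f(G,p)R_f(G,p)^{\top}\in\mathbb{R}^{d|V|\times d|V|}$. The stiffness matrix is $L(G,p)=L_f(G,p)$ with $f\equiv 1$. Local matrices: let $N_G(v)$ be the set of neighbors of $v$ and $\deg_G(v)=|N_G(v)|$. $R_f^v(G,p)\in\mathbb{R}^{d\times\deg_G(v)}$ is the matrix whose column indexed by $u\in N_G(v)$ is $\sqrt{f(u)}\,d_{vu}$, and $L_f^v(G,p)=R_f^v(G,p)R_f^v(G,p)^{\top}\in\mathbb{R}^{d\times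 d}$. Blow-up: for $a:V\to\mathbb{N}$, $G^{(a)}=(V^{(a)},E^{(a)})$ where $V^{(a)}=\{(v,i): v\in V,\ 1\le i\le a(v)\}$ and $E^{(a)}=\{\{(u,i),(v,j)\}: (u,i),(v,j)\in V^{(a)},\ \{u,v\}\in E\}$; and $p^{(a)}:V^{(a)}\to\mathbb{R}^d$ is $p^{(a)}((v,i))=p(v)$. For a symmetric real matrix $M$, $\mathrm{Spec}(M)$ is the multiset of its eigenvalues (with multiplicity). For a multiset $S$ and integer $k\ge 0$, $S^{[k]}$ is the multiset in which each element of $S$ is repeated $k$ times ($S^{[0]}=\emptyset$). Unions of multisets add multiplicities. *)

(* Defs.v *)
From HB Require Import structures.
From mathcomp Require Import all_boot all_order all_algebra.
From mathcomp Require Import finmap multiset.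
From mathcomp Require Import reals polyrcf.

Set Implicit Arguments.
Unset Strict Implicit.
Unset Printing Implicit Defensive.

Import Order.TTheory GRing.Theory Num.Theory.

Local Open Scope mset_scope.
Local Open Scope ring_scope.

Record sgraph (V : finType) := SGraph {
  adj :> rel V;
  adj_sym : symmetric adj;
  adj_irrefl : irreflexive adj
}.

Definition edges (V : finType) (G : sgraph V) : {set {set V}} :=
  [set e : {set V} | [exists u, exists v, G u v && (e == [set u; v])]].

Definition neighbors (V : finType) (G : sgraph V) (v : V) : {set V} :=
  [set u | G v u].

Section Blowup.

Context (V : finType) (G : sgraph V) (a : V -> nat).

(* The copies of v are numbered from 0 to a v - 1. *)
Definition blowup_vertex : finType := {v : V & 'I_(a v)}.

Definition blowup_rel : rel blowup_vertex := fun x y => G (tag x) (tag y).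

Fact blowup_sym : symmetric blowup_rel.
Proof. by move=> x y; apply: adj_sym. Qed.

Fact blowup_irrefl : irreflexive blowup_rel.
Proof. by move=> x; apply: adj_irrefl. Qed.

Definition blowup : sgraph blowup_vertex := SGraph blowup_sym blowup_irrefl.

Definition blowup_map (T : Type) (p : V -> T) : blowup_vertex -> T :=
  fun x => p (tag x).

End Blowup.

Section Rigidity.

Context (R : realType) (d : nat) (V : finType) (G : sgraph V).
Context (p : V -> 'rV[R]_d) (f : V -> R).

(* MathComp-Analysis equips 'rV[R]_d with the sup norm, hence this definition. *)
Definition enorm (x : 'rV[R]_d) : R := Num.sqrt (\sum_i x 0 i ^+ 2).

Definition dir (u v : V) : 'rV[R]_d :=
  if p u != p v then (enorm (p u - p v))^-1 *: (p u - p v) else 0.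

(* Rows and columns are numbered through the enumerations of V * 'I_d and of
   the edge set. When e is an edge there is at most one v with e = {u, v}. *)
Definition rigidity_mx : 'M[R]_(#|{: V * 'I_d}|, #|edges G|) :=
  \matrix_(r, c)
    let: (u, i) := enum_val r in
    if [pick v | enum_val c == [set u; v]] is Some v
    then Num.sqrt (f v) * dir u v 0 i else 0.

Definition weighted_stiffness_mx : 'M[R]_#|{: V * 'I_d}| :=
  rigidity_mx *m rigidity_mx^T.

Definition local_rigidity_mx (v : V) : 'M[R]_(d, #|neighbors G v|) :=
  \matrix_(i, c) (Num.sqrt (f (enum_val c)) * dir v (enum_val c) 0 i).

Definition local_stiffness_mx (v : V) : 'M[R]_d :=
  local_rigidity_mx v *m (local_rigidity_mx v)^T.

End Rigidity.

Definition stiffness_mx (R : realType) (d : nat) (V : finType) (G : sgraph V)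
    (p : V -> 'rV[R]_d) : 'M[R]_#|{: V * 'I_d}| :=
  weighted_stiffness_mx G p (fun=> 1).

(* The multiset of real eigenvalues with algebraic multiplicity; for a symmetric
   matrix these are all its eigenvalues. *)
Fact Spec_key : unit. Proof. exact: tt. Qed.
Definition Spec (R : realType) (n : nat) (M : 'M[R]_n) : {mset R} :=
  [mset[Spec_key] x in seq_fset tt (rootsR (char_poly M)) =>
     mup x (char_poly M)]%mset.

Lemma SpecE (R : realType) (n : nat) (M : 'M[R]_n) (x : R) :
  Spec M x = mup x (char_poly M).
Proof.
have p0 : char_poly M != 0 by rewrite monic_neq0 ?char_poly_monic.
rewrite fsfunE seq_fsetE -roots_on_rootsR // in_itv /=.
by case: ifPn => // /mupNroot ->.
Qed.

Lemma in_Spec (R : realType) (n : nat) (M : 'M[R]_n) (x : R) :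
  (x \in Spec M) = eigenvalue M x.
Proof.
have p0 : char_poly M != 0 by rewrite monic_neq0 ?char_poly_monic.
by rewrite -msuppE mem_finsupp SpecE eigenvalue_root_char -lt0n -XsubC_dvd //
  dvdp_XsubCl.
Qed.

Definition mset_repeat (K : choiceType) (S : {mset K}) (k : nat) : {mset K} :=
  iter k (msetD S) mset0.

Lemma mset_repeatE (K : choiceType) (S : {mset K}) (k : nat) (x : K) :
  mset_repeat S k x = (k * S x)%N.
Proof.
by elim: k => [|k IHk]; rewrite ?mset0E // /mset_repeat iterS msetE2 IHk mulSn.
Qed.

(* Main.v *)
Require Import Defs.
From HB Require Import structures.
From mathcomp Require Import all_boot all_order perm all_algebra.
From mathcomp Require Import finmap multiset.
From mathcomp Require Import boolp reals ring.

Import Order.TTheory GRing.Theory Num.Theory.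

Set Implicit Arguments.
Unset Strict Implicit.
Unset Printing Implicit Defensive.

Local Open Scope ring_scope.

(** The multiset of real eigenvalues is read off the characteristic polynomial,
    so it suffices to factor the characteristic polynomial of the stiffness
    matrix of the blow-up.

    A weighted stiffness matrix has the form D - C, where D is block diagonal
    with the local stiffness matrices as its d x d blocks, and C is supported on
    the blocks of pairs of adjacent vertices ([weighted_stiffnessE]); write
    D_a - C_a for the weighted stiffness matrix L_a(G, p). Let Q be
    the matrix whose columns are the normalized indicator vectors of the fibres
    of the blow-up over the vertices of G, one for each coordinate. Then
    Q^T Q = 1. The diagonal part D' of the stiffness matrix of the blow-up has
    the same block L_a^v at all copies of v, because summing over the copies of
    a neighbour w multiplies its contribution by a(w); hence D' Q = Q D_a. The
    coupling part of the blow-up depends only on the fibres, and is Q C_a Q^T.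

    So the matrix to study is D' - Q C_a Q^T. For A Q = Q B, the determinants
    of A + Q P and B + P Q are related by
      det (A + Q P) * det B = det A * det (B + P Q)
    ([det_addmul_intertwine]), a variant of Sylvester's identity without
    inverses, which can be applied to characteristic matrices. With P = - C_a Q^T
    and P Q = - C_a it yields
      char (D' - Q C_a Q^T) * prod_v char (L_a^v)
        = prod_v char (L_a^v) ^ a(v) * char (D_a - C_a),
    and the monic factor prod_v char (L_a^v) cancels ([char_poly_blowup]). *)

(** * Perturbations that factor through an intertwining matrix *)

(** Eliminating the lower right corner of the block matrix (A, -Q; P, 1) gives
    det (A + Q P). Multiplying it on the right by (1, Q; 0, B) instead clears its
    upper right corner, since A Q = Q B, and leaves A and B + P Q on the
    diagonal. *)
Lemma det_addmul_intertwine (R : comPzRingType) (m n : nat) (A : 'M[R]_m)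
    (B : 'M[R]_n) (Q : 'M[R]_(m, n)) (P : 'M[R]_(n, m)) :
  A *m Q = Q *m B ->
  \det (A + Q *m P) * \det B = \det A * \det (B + P *m Q).
Proof.
move=> AQ.
have detN : \det (block_mx A (- Q) P 1%:M) = \det (A + Q *m P).
  transitivity
      (\det (block_mx (1%:M : 'M_m) Q 0 1%:M *m block_mx A (- Q) P 1%:M)).
    by rewrite det_mulmx det_ublock !det1 !mul1r.
  rewrite mulmx_block !mul1mx !mul0mx !mulmx1 addNr !add0r.
  by rewrite det_lblock det1 mulr1.
transitivity (\det (block_mx A (- Q) P 1%:M *m block_mx (1%:M : 'M_m) Q 0 B)).
  by rewrite det_mulmx det_ublock det1 mul1r detN.
rewrite mulmx_block !mulmx1 !mulmx0 !addr0 AQ mulNmx subrr mul1mx det_lblock.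
by rewrite [P *m Q + B]addrC.
Qed.

Lemma char_poly_addmul_intertwine (R : comNzRingType) (m n : nat) (A : 'M[R]_m)
    (B : 'M[R]_n) (Q : 'M[R]_(m, n)) (P : 'M[R]_(n, m)) :
  A *m Q = Q *m B ->
  char_poly (A + Q *m P) * char_poly B = char_poly A * char_poly (B + P *m Q).
Proof.
move=> AQ; pose C := map_mx (@polyC R).
have char_mxD k (M N : 'M[R]_k) :
    char_poly_mx (M + N) = char_poly_mx M - C k k N.
  by rewrite /char_poly_mx /C map_mxD opprD addrA.
have := @det_addmul_intertwine _ _ _ (char_poly_mx A) (char_poly_mx B)
  (C _ _ Q) (- C _ _ P).
rewrite !mulmxN !mulNmx -!map_mxM -!char_mxD; apply.
by rewrite /char_poly_mx mulmxBl mulmxBr scalar_mxC /C -!map_mxM AQ.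
Qed.

(** * Block diagonal matrices indexed by a finite type *)

Lemma det_mxsub_bij (R : comPzRingType) (m n : nat) (f : 'I_m -> 'I_n)
    (A : 'M[R]_n) : bijective f -> \det (mxsub f f A) = \det A.
Proof.
move=> f_bij; have := bij_eq_card f_bij; rewrite !card_ord => mn.
move: f f_bij; rewrite mn => f /bij_inj f_inj.
have -> : mxsub f f A = row_perm (perm f_inj) (col_perm (perm f_inj) A).
  by apply/matrixP=> i j; rewrite !mxE !permE.
rewrite row_permE col_permE !det_mulmx !det_perm mulrCA -signr_addb.
by rewrite odd_permV addbb mulr1.
Qed.

Section BlockDiagonal.

(** Unlike [mxdiag], it is indexed through the enumeration of the pairs (block,
    coordinate), which is how the rows of a rigidity matrix are numbered. *)
Definition blockdiag (R : nmodType) (T : finType) (d : nat) (B : T -> 'M[R]_d) :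
    'M[R]_#|{: T * 'I_d}| :=
  \matrix_(r, c) let: (t, i) := enum_val r in let: (u, j) := enum_val c in
    if t == u then B t i j else 0.

Lemma sum_enum_val_pair (R : nmodType) (T : finType) (d : nat)
    (F : T * 'I_d -> R) :
  \sum_(k < #|{: T * 'I_d}|) F (enum_val k) = \sum_t \sum_i F (t, i).
Proof.
rewrite -(big_enum_val F) pair_bigA /=.
by apply: eq_big => [[t i]|[t i] _].
Qed.

Lemma det_mxdiag (R : comPzRingType) (p : nat) (s : 'I_p -> nat)
    (B : forall i, 'M[R]_(s i)) :
  \det (\mxdiag_i B i) = \prod_i \det (B i).
Proof.
elim: p s B => [|p IHp] s B.
  by move: (\mxdiag_i B i); rewrite !big_ord0 => M; apply: det_mx00.
have det_cast k l (e : k = l) (M : 'M[R]_k) : \det (castmx (e, e) M) = \det M.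
  by case: _ / e; rewrite castmx_id.
by rewrite mxdiag_recl det_cast det_ublock IHp big_ord_recl.
Qed.

Lemma det_blockdiag (R : comPzRingType) (T : finType) (d : nat)
    (B : T -> 'M[R]_d) :
  \det (blockdiag B) = \prod_t \det (B t).
Proof.
(* The renumbering from the layout of mxdiag to the enumeration of T * 'I_d. *)
pose f (k : 'I_(\sum_(t < #|T|) d)) : 'I_#|{: T * 'I_d}| :=
  enum_rank (enum_val (tagnat.sig1 k), tagnat.sig2 k).
have f_bij : bijective f.
  pose h (x : {t : 'I_#|T| & 'I_d}) : T * 'I_d := (enum_val (tag x), tagged x).
  have h_bij : bijective h.
    exists (fun y => existT (fun=> 'I_d) (enum_rank y.1) y.2) => [[t i]|[t i]].
      by rewrite /= enum_valK.
    by rewrite /h /= enum_rankK.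
  have sig_bij := @tagnat.sig_bij #|T| (fun=> d).
  have := bij_comp (@enum_rank_bij (T * 'I_d)%type) (bij_comp h_bij sig_bij).
  exact.
rewrite -(det_mxsub_bij _ f_bij).
transitivity (\det (\mxdiag_(t < #|T|) B (enum_val t))).
  congr (\det _); apply/matrixP=> r c; rewrite !mxE !enum_rankK.
  rewrite (inj_eq enum_val_inj).
  by case: eqP => [e|_]; rewrite ?conform_mx_id ?mxE.
by rewrite det_mxdiag -(big_enum_val (fun t => \det (B t))).
Qed.

Lemma char_poly_blockdiag (R : comNzRingType) (T : finType) (d : nat)
    (B : T -> 'M[R]_d) :
  char_poly (blockdiag B) = \prod_t char_poly (B t).
Proof.
rewrite -(det_blockdiag (fun t => char_poly_mx (B t))); congr (\det _).
apply/matrixP=> r c; rewrite !mxE -(inj_eq enum_val_inj).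
case: (enum_val r) (enum_val c) => [t i] [u j]; rewrite xpair_eqE.
by case: eqP => [->|_]; rewrite ?mxE ?mulr0n ?polyC0 ?subr0.
Qed.

End BlockDiagonal.

(** * The stiffness matrix: local blocks and coupling *)

Lemma dir_anti (R : realType) (d : nat) (V : finType) (p : V -> 'rV[R]_d)
    (u v : V) :
  dir p v u = - dir p u v.
Proof.
rewrite /dir eq_sym; case: ifP => _; last by rewrite oppr0.
have -> : enorm (p v - p u) = enorm (p u - p v).
  congr (Num.sqrt _); apply: eq_bigr => i _.
  by rewrite !mxE -sqrrN opprB.
by rewrite -scalerN opprB.
Qed.

Lemma pick_set2 (V : finType) (u v w : V) : u != v ->
  [pick x | [set u; v] == [set w; x]] =
  if w == u then Some v else if w == v then Some u else None.
Proof.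
move=> uv; case: pickP => [x /eqP e|noV].
  have: (w \in [set u; v]) && (u \in [set w; x]) && (v \in [set w; x]).
    by rewrite e set21 -e set21 set22.
  rewrite !inE; case: eqVneq => [->|_] /=.
    by rewrite eq_sym (negPf uv) => /eqP->.
  by case: eqVneq => //= _ /andP[/eqP-> //].
case: eqVneq => [wu|_]; first by have := noV v; rewrite wu eqxx.
by case: eqVneq => // wv; have := noV u; rewrite wv setUC eqxx.
Qed.

Section Stiffness.

Context (R : realType) (d : nat) (V : finType) (G : sgraph V).
Context (p : V -> 'rV[R]_d) (f : V -> R).

(** The part of the stiffness matrix that joins distinct vertices, with the sign
    changed: the direction of an edge is reversed at its other end. *)
Definition coupling_mx : 'M[R]_#|{: V * 'I_d}| :=
  \matrix_(r, c) let: (u, i) := enum_val r in let: (v, j) := enum_val c in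
    if G u v
    then Num.sqrt (f u) * Num.sqrt (f v) * (dir p u v 0 i * dir p u v 0 j)
    else 0.

Lemma local_stiffnessE (v : V) (i j : 'I_d) :
  local_stiffness_mx G p f v i j =
  \sum_(w | G v w) Num.sqrt (f w) ^+ 2 * (dir p v w 0 i * dir p v w 0 j).
Proof.
rewrite !mxE; under eq_bigr do rewrite !mxE mulrACA -expr2.
rewrite -(big_enum_val (fun w => Num.sqrt (f w) ^+ 2 *
  (dir p v w 0 i * dir p v w 0 j))).
by apply: eq_bigl => w; rewrite inE.
Qed.

Lemma sum_incident_edges (u : V) (F : {set V} -> R) :
  (forall e, e \in edges G -> u \notin e -> F e = 0) ->
  \sum_(e in edges G) F e = \sum_(v | G u v) F [set u; v].
Proof.
move=> F0; rewrite (bigID (fun e : {set V} => u \in e)) /= addrC.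
rewrite big1 ?add0r; last first.
  by move=> e /andP[eG ue]; apply: F0.
transitivity (\sum_(e in [set [set u; v] | v in neighbors G u]) F e).
  apply: eq_bigl => e; apply/andP/imsetP.
    case; rewrite inE => /existsP[v /existsP[w /andP[vw /eqP->]]].
    rewrite !inE => /orP[]/eqP->; first by exists w; rewrite ?inE.
    by exists v; rewrite ?inE 1?adj_sym // setUC.
  case=> v; rewrite inE => uv ->; rewrite set21 inE; split=> //.
  by apply/existsP; exists u; apply/existsP; exists v; rewrite uv eqxx.
rewrite big_imset /=; first by apply: eq_bigl => v; rewrite inE.
move=> v w; rewrite !inE => uv uw e; have := set22 u v; rewrite e !inE.
by case: eqVneq uv => [->|_ _ /eqP]; first by rewrite adj_irrefl.
Qed.

(** Entry ((u, i), (w, j)) of R_f R_f^T is a sum over the edges at u. All of them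
    contribute if w = u, and these terms form the local stiffness matrix; if
    w <> u only the edge {u, w} does, and [dir_anti] gives the minus sign. *)
Lemma weighted_stiffnessE :
  weighted_stiffness_mx G p f =
  blockdiag (local_stiffness_mx G p f) - coupling_mx.
Proof.
(* The entry of the rigidity matrix in row x and in the column of the edge e. *)
pose ent (x : V * 'I_d) (e : {set V}) :=
  if [pick v | e == [set x.1; v]] is Some v
  then Num.sqrt (f v) * dir p x.1 v 0 x.2 else 0.
have entE x u v : G u v -> ent x [set u; v] =
    if x.1 == u then Num.sqrt (f v) * dir p u v 0 x.2
    else if x.1 == v then Num.sqrt (f u) * dir p v u 0 x.2 else 0.
  move=> uv; rewrite /ent pick_set2; last first.
    by apply: contraTneq uv => ->; rewrite adj_irrefl.
  by case: eqP => [->|_] //; case: eqP => [->|_].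
apply/matrixP=> r c.
have -> : weighted_stiffness_mx G p f r c =
    \sum_(e in edges G) ent (enum_val r) e * ent (enum_val c) e.
  rewrite mxE (big_enum_val (fun e => ent (enum_val r) e * ent (enum_val c) e)).
  apply: eq_bigr => k _; rewrite !mxE /ent.
  by case: (enum_val r) (enum_val c) => [u i] [v j].
rewrite !mxE; case: (enum_val r) (enum_val c) => [u i] [w j].
rewrite (@sum_incident_edges u); last first.
  move=> e _ ue; rewrite /ent /=.
  case: pickP => [x /eqP ex|]; last by rewrite mul0r.
  by rewrite ex set21 in ue.
under eq_bigr => v uv do rewrite !entE //= eqxx.
case: (eqVneq u w) => [<-|uw].
  rewrite adj_irrefl subr0 local_stiffnessE; apply: eq_bigr => v uv.
  by rewrite mulrACA -expr2.
rewrite sub0r; case: ifPn => [Guw|/negPf nGuw].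
  rewrite (bigD1 w) //= eqxx big1 => [|v /andP[_ /negPf]]; last first.
    by rewrite eq_sym => ->; rewrite mulr0.
  rewrite addr0 (dir_anti p u w) mxE !mulrN mulrACA.
  by rewrite [Num.sqrt (f w) * _]mulrC.
rewrite big1 ?oppr0 // => v uv; case: eqP => [wv|_]; last by rewrite mulr0.
by rewrite -wv nGuw in uv.
Qed.

End Stiffness.

(** * The blow-up *)

Section Blowup.

Context (R : realType) (d : nat) (V : finType) (G : sgraph V).
Context (p : V -> 'rV[R]_d) (a : V -> nat).

Let weight (v : V) : R := (a v)%:R.
Let W := blowup_vertex a.

Lemma sum_blowup (F : V -> R) :
  \sum_(x : W) F (tag x) = \sum_v weight v * F v.
Proof.
transitivity (\sum_v \sum_(k < a v) F v); last first.
  by apply: eq_bigr => v _; rewrite sumr_const card_ord mulr_natl.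
by rewrite sig_big_dep.
Qed.

Lemma sqr_sqrt_weight (v : V) : Num.sqrt (weight v) ^+ 2 = weight v.
Proof. by rewrite sqr_sqrtr ?ler0n. Qed.

Lemma local_stiffness_blowup (x : W) :
  local_stiffness_mx (blowup G a) (blowup_map p) (fun=> 1) x =
  local_stiffness_mx G p weight (tag x).
Proof.
apply/matrixP=> i j; rewrite !local_stiffnessE.
rewrite big_mkcond [RHS]big_mkcond /=.
pose F (w : V) : R := if G (tag x) w
  then dir p (tag x) w 0 i * dir p (tag x) w 0 j else 0.
transitivity (\sum_(y : W) F (tag y)).
  apply: eq_bigr => y _; rewrite /F /blowup_rel.
  by case: ifP; rewrite // sqrtr1 expr1n mul1r.
rewrite sum_blowup; apply: eq_bigr => w _.
by rewrite /F sqr_sqrt_weight; case: ifP; rewrite ?mulr0.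
Qed.

(** The columns are the indicator vectors of the fibres tag^-1(v), one for each
    coordinate, scaled to norm 1: the fibre over v has a(v) elements. *)
Definition fibre_mx : 'M[R]_(#|{: W * 'I_d}|, #|{: V * 'I_d}|) :=
  \matrix_(r, c) let: (x, i) := enum_val r in let: (v, j) := enum_val c in
    if (tag x == v) && (i == j) then (Num.sqrt (weight v))^-1 else 0.

Lemma mul_fibre_mx n (M : 'M[R]_(#|{: V * 'I_d}|, n)) r c :
  (fibre_mx *m M) r c =
  let: (x, i) := enum_val r in
  (Num.sqrt (weight (tag x)))^-1 * M (enum_rank (tag x, i)) c.
Proof.
rewrite mxE; case E: (enum_val r) => [x i].
rewrite (bigD1 (enum_rank (tag x, i))) //= big1 ?addr0 => [|k].
  by rewrite !mxE E enum_rankK !eqxx.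
rewrite -(inj_eq enum_val_inj) enum_rankK !mxE E.
case: (enum_val k) => [v j]; rewrite xpair_eqE [v == _]eq_sym [j == _]eq_sym.
by move=> /negPf->; rewrite mul0r.
Qed.

(** A vertex of the blow-up is itself a witness that its fibre is nonempty. *)
Lemma sqrt_weight_neq0 (x : W) : Num.sqrt (weight (tag x)) != 0.
Proof.
rewrite gt_eqF // sqrtr_gt0 ltr0n.
exact: leq_ltn_trans (ltn_ord (tagged x)).
Qed.

(** The weights sqrt a(u) sqrt a(v) of the coupling in G are cancelled by the
    normalization of the indicator vectors. *)
Lemma fibre_coupling :
  fibre_mx *m coupling_mx G p weight *m fibre_mx^T =
  coupling_mx (blowup G a) (blowup_map p) (fun=> 1).
Proof.
rewrite -[LHS]trmxK trmx_mul trmxK; apply/matrixP=> r c.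
rewrite [LHS]mxE mul_fibre_mx [RHS]mxE.
case: (enum_val c) => [y j]; rewrite mxE mul_fibre_mx.
case: (enum_val r) => [x i]; rewrite mxE !enum_rankK /= /blowup_rel.
case: ifP => _; last by rewrite !mulr0.
rewrite sqrtr1 !mul1r.
have [x0 y0] := (sqrt_weight_neq0 x, sqrt_weight_neq0 y).
by rewrite /dir /blowup_map; field; rewrite x0 y0.
Qed.

Lemma blockdiag_fibre (B : V -> 'M[R]_d) :
  blockdiag (fun x : W => B (tag x)) *m fibre_mx = fibre_mx *m blockdiag B.
Proof.
apply/matrixP=> r c; rewrite mul_fibre_mx !mxE.
pose F (y : W * 'I_d) : R :=
  (let: (x, i) := enum_val r in if x == y.1 then B (tag x) i y.2 else 0) *
  (let: (v, j) := enum_val c in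
   if (tag y.1 == v) && (y.2 == j) then (Num.sqrt (weight v))^-1 else 0).
transitivity (\sum_(k < #|{: W * 'I_d}|) F (enum_val k)).
  apply: eq_bigr => k _; rewrite !mxE /F.
  by case: (enum_val r) (enum_val k) (enum_val c) => [x i] [y k'] [v j].
rewrite sum_enum_val_pair /F.
case: (enum_val r) => [x i]; rewrite mxE enum_rankK.
case: (enum_val c) => [v j] /=.
rewrite (bigD1 x) //= eqxx [X in _ + X]big1 ?addr0; last first.
  by move=> y /negPf yx; rewrite big1 // => k _; rewrite eq_sym yx mul0r.
case: eqVneq => [->|_] /=; last by rewrite big1 ?mulr0 // => k _; rewrite mulr0.
rewrite (bigD1 j) //= eqxx big1 => [|k /negPf->]; last by rewrite mulr0.
by rewrite addr0 mulrC.
Qed.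

Lemma fibre_isometry :
  (forall v, (0 < a v)%N) -> fibre_mx^T *m fibre_mx = 1%:M.
Proof.
move=> a_gt0; apply/matrixP=> r c; rewrite [LHS]mxE [RHS]mxE.
rewrite -(inj_eq enum_val_inj).
pose F (y : V * 'I_d) : R :=
  (if y == enum_val r then (Num.sqrt (weight (enum_val r).1))^-1 else 0) *
  (if y == enum_val c then (Num.sqrt (weight (enum_val c).1))^-1 else 0).
transitivity (\sum_(k < #|{: W * 'I_d}|) F (tag (enum_val k).1, (enum_val k).2)).
  apply: eq_bigr => k _; rewrite !mxE /F.
  case: (enum_val r) (enum_val k) (enum_val c) => [u i] [x k'] [v j].
  by rewrite !xpair_eqE.
rewrite (sum_enum_val_pair (fun y => F (tag y.1, y.2))) /=.
rewrite (sum_blowup (fun v => \sum_i F (v, i))).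
under eq_bigr do rewrite mulr_sumr.
rewrite pair_bigA /= (bigD1 (enum_val r)) //= big1 ?addr0 => [|y]; last first.
  by rewrite /F -surjective_pairing => /negPf->; rewrite mul0r mulr0.
rewrite /F -surjective_pairing eqxx; case: eqP => [<-|_]; last by rewrite !mulr0.
rewrite -expr2 exprVn sqr_sqrt_weight mulfV //.
by rewrite pnatr_eq0 -lt0n.
Qed.

Lemma char_poly_blowup :
  (forall v, (0 < a v)%N) ->
  char_poly (stiffness_mx (blowup G a) (blowup_map p)) =
  (\prod_v char_poly (local_stiffness_mx G p weight v) ^+ (a v - 1)) *
  char_poly (weighted_stiffness_mx G p weight).
Proof.
move=> a_gt0; set L := local_stiffness_mx G p weight.
pose B := blockdiag L; pose C := coupling_mx G p weight.
have B_neq0 : char_poly B != 0 by rewrite monic_neq0 ?char_poly_monic.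
have := char_poly_addmul_intertwine (- C *m fibre_mx^T) (blockdiag_fibre L).
rewrite -mulmxA (fibre_isometry a_gt0) mulmx1 mulNmx mulmxN mulmxA.
rewrite fibre_coupling -weighted_stiffnessE.
rewrite (_ : blockdiag _ = blockdiag (local_stiffness_mx (blowup G a)
  (blowup_map p) (fun=> 1))); last first.
  by congr blockdiag; apply: funext => x; rewrite local_stiffness_blowup.
rewrite -weighted_stiffnessE !char_poly_blockdiag => E.
apply: (mulIf B_neq0); rewrite /stiffness_mx /B char_poly_blockdiag E.
rewrite mulrAC -big_split /=; congr (_ * _).
under eq_bigr do rewrite local_stiffness_blowup.
transitivity (\prod_v \prod_(k < a v) char_poly (L v)).
  by rewrite sig_big_dep.
apply: eq_bigr => v _; rewrite prodr_const card_ord.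
by rewrite -exprSr subn1 prednK.
Qed.

End Blowup.

(** * Spectra *)

Theorem theorem1p1 (R : realType) (d : nat) (hd : (0 < d)%N) (V : finType)
    (G : sgraph V) (p : V -> 'rV[R]_d) (a : V -> nat)
    (ha : forall v, (0 < a v)%N) :
  Spec (stiffness_mx (blowup G a) (blowup_map p)) =
  ((\big[msetD/mset0]_(v : V)
      mset_repeat (Spec (local_stiffness_mx G p (fun u => (a u)%:R) v))
                  (a v - 1))
   `+` Spec (weighted_stiffness_mx G p (fun u => (a u)%:R)))%mset.
Proof.
have char_neq0 n (M : 'M[R]_n) : char_poly M != 0.
  by rewrite monic_neq0 ?char_poly_monic.
apply/msetP=> x; rewrite msetE2 !SpecE char_poly_blowup //.
rewrite mupM // ?prodf_seq_neq0; last first.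
  by apply/allP=> v _; rewrite expf_neq0 ?char_neq0 ?implybT.
congr (_ + _)%N.
have mupXn k (q : {poly R}) : q != 0 -> mup x (q ^+ k) = (k * mup x q)%N.
  move=> q0; elim: k => [|k IHk]; first by rewrite mupNroot // rootC oner_eq0.
  by rewrite exprS mupM ?expf_neq0 // IHk mulSn.
elim: (index_enum V) => [|v s IHs].
  by rewrite !big_nil mset0E mupNroot // rootC oner_eq0.
rewrite !big_cons msetE2 mset_repeatE SpecE mupM ?expf_neq0 ?mupXn ?IHs //.
by rewrite prodf_seq_neq0; apply/allP=> u _; rewrite expf_neq0.
Qed.
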